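(* For the topdrop map on $S_n$: (1) If $n\ge2$, there are exactly $(n-2)!$ orbits of size two. (2) There are no orbits of size three (for any $n$). (3) If $n\ge3$, there are exactly $(n-2)!$ orbits of size four. (4) If $n\ge7$, the number of orbits of size five is $(n-6)(n-5)!$ if $n$ is even and $(n-5)(n-5)!$ if $n$ is odd. (5) If $n\ge4$, the number of orbits of size six is at least $(2n^2-11n+14)(n-4)!$ if $n$ is even and at least $(2n^2-12n+18)(n-4)!$ if $n$ is odd. (6) If $n\ge5$, the number of orbits of size eight is at least $\left(\tfrac32n^3-\tfrac{35}{2}n^2+64n-70\right)(n-5)!$ if $n\equiv0$ or $2\pmod 6$; $\left(\tfrac32n^3-\tfrac{35}{2}n^2+\tfrac{137}{2}n-\tfrac{181}{2}\right)(n-5)!$ if $n\equiv1\pmod 6$; $\left(\tfrac32n^3-\tfrac{35}{2}n^2+\tfrac{135}{2}n-\tfrac{171}{2}\right)(n-5)!$ if $n\equiv3$ or $5\pmod 6$; $\left(\tfrac32n^3-\tfrac{35}{2}n^2+66n-80\right)(n-5)!$ if $n\equiv4\pmod 6$.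
   Context: Permutations are in one-line notation $\pi=\pi_1\cdots\pi_n$. The topdrop map $T:S_n\to S_n$ is $T(\pi_1\cdots\pi_n)=\pi_{\pi_1+1}\cdots\pi_n\,\pi_{\pi_1}\pi_{\pi_1-1}\cdots\pi_1$ (first $\pi_1$ entries removed, reversed, appended at the end); it is a bijection. The orbit of $\pi$ is $(\pi,T(\pi),\dots,T^{s-1}(\pi))$ with $s\ge1$ minimal such that $T^s(\pi)=\pi$; $s$ is the size of the orbit. *)

(* Defs.v *)
From mathcomp Require Import all_boot all_algebra all_fingroup.
From mathcomp Require Import zify.

Set Implicit Arguments.
Unset Strict Implicit.
Unset Printing Implicit Defensive.

(* Ordinals are 0-based, so the i-th letter of the word (i : 'I_n) is
   (p i).+1, and the first letter is the one at i = 0. *)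
Definition oneline n (p : 'S_n) : seq nat := [seq (p i).+1 | i <- enum 'I_n].

Definition topdrop_word (w : seq nat) : seq nat :=
  drop (head 0 w) w ++ rev (take (head 0 w) w).

(* Removing the first k letters of a word of length n, reversing them and
   appending them at the end puts in position i the letter that was in
   position i + k if i + k < n, and in the mirror position n - 1 - i
   otherwise. *)
Definition topdrop_pos n (k : nat) (i : 'I_n) : 'I_n :=
  insubd (rev_ord i) (i + k).

Lemma val_topdrop_pos n k (i : 'I_n) :
  topdrop_pos k i = (if i + k < n then i + k else n - i.+1) :> nat.
Proof. by rewrite /topdrop_pos val_insubd. Qed.

Lemma topdrop_pos_inj n k : injective (@topdrop_pos n k).
Proof.
move=> i j /(congr1 val); rewrite /= !val_topdrop_pos => eq_ij.
apply/val_inj => /=; move: eq_ij (ltn_ord i) (ltn_ord j).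
by case: ifP; case: ifP; lia.
Qed.

(* Products of permutations compose left to right, so this is
   i |-> p (topdrop_pos k i) where k is the first letter of p. *)
Definition topdrop n (p : 'S_n) : 'S_n :=
  (perm (@topdrop_pos_inj n (head 0 (oneline p))) * p)%g.

Lemma oneline_topdrop n (p : 'S_n) :
  oneline (topdrop p) = topdrop_word (oneline p).
Proof.
have sz (q : 'S_n) : size (oneline q) = n by rewrite size_map size_enum_ord.
have nthE (q : 'S_n) (i : 'I_n) : nth 0 (oneline q) i = (q i).+1.
  by rewrite (nth_map i) ?size_enum_ord // nth_ord_enum.
rewrite /topdrop_word; set k := head 0 (oneline p).
have le_kn : k <= n.
  rewrite /k -nth0; case: n p {sz k} nthE => [|m] p nthE.
    by rewrite nth_default // size_map size_enum_ord.
  by rewrite (nthE p ord0) ltn_ord.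
apply: (@eq_from_nth _ 0).
  by rewrite size_cat size_rev size_drop size_takel ?sz ?subnK.
rewrite sz => i lt_in; rewrite -[i]/(val (Ordinal lt_in)) nthE.
rewrite permM permE -nthE val_topdrop_pos -/k /= nth_cat size_drop sz.
rewrite ltn_subRL [k + i]addnC; case: ltnP => [_ | le_n_ik].
  by rewrite nth_drop addnC.
rewrite nth_rev size_takel ?sz //; last by lia.
by rewrite nth_take; [congr nth; lia | lia].
Qed.

Lemma topdrop_inj n : injective (@topdrop n).
Proof.
move=> p q eq_pq.
have last_td (r : 'S_n) : last 0 (oneline (topdrop r)) = head 0 (oneline r).
  rewrite oneline_topdrop /topdrop_word /oneline.
  by case: (enum 'I_n) => //= i s; rewrite rev_cons last_cat last_rcons.
have eq_k : head 0 (oneline p) = head 0 (oneline q) by rewrite -!last_td eq_pq.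
by move: eq_pq; rewrite /topdrop eq_k => /mulgI.
Qed.

Definition topdrop_perm n : {perm 'S_n} := perm (@topdrop_inj n).

Definition num_orbits n (s : nat) : nat :=
  #|[set O in porbits (topdrop_perm n) | #|O| == s]|.

(* Main.v *)
Require Import Defs.
From mathcomp Require Import all_boot all_order all_algebra all_fingroup.
From mathcomp Require Import zify ring lra.

(* A permutation with given first s heads (the heads of p, T p, .., T^(s-1) p)
   is one with prescribed letters at prescribed positions, so there are (n - s)!
   of them when the heads and the positions are distinct, and counting orbits
   amounts to counting head sequences.

   Topdrop is inverted by conjugation with the reversal R, and T p = R p exactly
   when p starts with n - 1 or n. Hence an orbit that meets such a p retraces
   its steps: of odd size it cannot exist, and of even size 2m it meets a second
   such element m steps later. This yields all orbits of size two and four, and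
   the families of sizes six and eight with heads n, w, n - 1, rev w or A, w, A,
   rev w.

   When no head exceeds n - 2, every move cuts one pair of neighbouring letters
   and joins a new pair, and all of these must be undone within the period.
   Following the new pair until it is cut again gives linear equations between
   the heads; they are contradictory for sizes three and four, and for size five
   they leave only the heads 1, n - b - 1, b + 1, n - b, b. *)

Set Implicit Arguments.
Unset Strict Implicit.
Unset Printing Implicit Defensive.

Import Order.TTheory GRing.Theory Num.Theory.

(** * Counting orbits by representatives and permutations by prescribed letters *)

(** Under the two hypotheses a point of F has orbit size exactly s and no other point of F in its
    orbit, so [porbit f] embeds F into the orbits of size s. The equality case says that every such
    orbit meets F. *)
Lemma card_orbits_le (T : finType) (f : {perm T}) (s : nat) (F : {set T}) :
  0 < s -> {in F, forall x, iter s f x = x} ->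
  {in F, forall x j, 0 < j < s -> iter j f x \notin F} ->
  #|F| <= #|[set O in porbits f | #|O| == s]|
    ?= iff [forall x, (#|porbit f x| == s) ==> [exists y in porbit f x, y \in F]].
Proof.
move=> s_gt0 per_F free_F.
have card_F x : x \in F -> #|porbit f x| = s.
  move=> Fx; apply/eqP; rewrite eqn_leq; apply/andP; split; rewrite leqNgt; apply/negP => lt.
    have /(_ _ 0) := uniqP x (uniq_traject_porbit f x).
    move=> /(_ s); rewrite !inE size_traject lt (ltn_trans s_gt0 lt) => /(_ isT isT).
    by rewrite !nth_traject ?(ltn_trans s_gt0 lt) //= per_F //
      => /(_ erefl) s0; rewrite s0 in s_gt0.
  (* The return to x after [#|porbit f x|] moves is a return to F, which rules out a size below
     s. *)
  have := free_F x Fx #|porbit f x|.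
  rewrite lt iter_porbit Fx card_gt0 => /(_ _)/negP[] //.
  by rewrite andbT; apply/set0Pn; exists x; exact: porbit_id.
have inj_F : {in F &, injective (porbit f)}.
  move=> x y Fx Fy eq_xy; have : y \in porbit f x by rewrite eq_xy porbit_id.
  rewrite porbit_traject card_F // => /trajectP[[//|j] lt_j Dy].
  by have := free_F x Fx j.+1 lt_j; rewrite -Dy Fy.
rewrite -(card_in_imset inj_F).
have subF : [set porbit f x | x in F] \subset [set O in porbits f | #|O| == s].
  apply/subsetP => _ /imsetP[x Fx ->]; rewrite inE card_F // eqxx andbT.
  exact: imset_f.
split; first exact: subset_leq_card.
rewrite (subset_leqif_card subF); apply/subsetP/forallP => [sub x | all_F O].
  apply/implyP => card_x; have /imsetP[y Fy Dx] : porbit f x \in [set porbit f x | x in F].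
    by apply: sub; rewrite inE card_x imset_f.
  by apply/existsP; exists y; rewrite Dx porbit_id.
rewrite inE => /andP[/imsetP[x _ ->] cx].
have /existsP[y /andP[xy Fy]] := implyP (all_F x) cx.
apply/imsetP; exists y => //.
by apply/eqP; rewrite eq_porbit_mem porbit_sym.
Qed.

(** These permutations form a coset of the pointwise stabilizer of s: with one solution q fixed,
    they are the r q where r moves only positions outside s. *)
Lemma card_perm_prescribed n (s t : seq 'I_n) :
  uniq s -> uniq t -> size s = size t ->
  #|[set p : 'S_n | map p s == t]| = (n - size s)`!.
Proof.
move=> us ut eq_st.
have [q Dq] : exists q : 'S_n, map q s = t.
  elim: s t us ut eq_st => [|a s IH] [|b t] //=; first by exists 1%g.
  case/andP => sa us /andP[tb ut] [/(IH _ us ut) [q Dq]].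
  (* The transposition puts b at a and leaves the letters already placed alone, since these differ
     from [q a] and from b. *)
  exists (q * tperm (q a) b)%g; rewrite permM tpermL; congr (_ :: _).
  rewrite -Dq; apply/eq_in_map => i si; rewrite permM tpermD //.
    by rewrite (inj_eq perm_inj); apply: contraNneq sa => ->.
  by apply: contraNneq tb => ->; rewrite -Dq map_f.
have -> : [set p : 'S_n | map p s == t] = [set (r * q)%g | r in perm_on (~: [set i in s])].
  apply/setP => p; rewrite !inE; apply/eqP/imsetP => [Dp | [r r_on ->]].
    exists (p * q^-1)%g; last by rewrite mulgKV.
    apply/subsetP => i; rewrite !inE; apply: contra => si.
    rewrite permM; apply/eqP/(can_inj (permK q)); rewrite permKV.
    by have /eq_in_map -> : map p s = map q s by rewrite Dp.
  rewrite -Dq; apply/eq_in_map => i si; rewrite permM; congr (q _).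
  by apply: (out_perm r_on); rewrite !inE si.
rewrite card_imset; last exact: mulIg.
rewrite card_perm cardsCs setCK cardsE card_ord.
by rewrite (card_uniqP us).
Qed.

(** * Letters and their positions under one move *)

(* The letter of topdrop p at position i comes from position pull n i k of p,
   where k is the head of p; push n _ k is the inverse. *)
Definition pull n (i k : nat) := if i + k < n then i + k else n - i.+1.
Definition push n (i k : nat) := if k <= i then i - k else n - i.+1.

Lemma pull_lt n i k : i < n -> pull n i k < n.
Proof. by rewrite /pull; case: ifP; lia. Qed.

Lemma push_lt n i k : i < n -> push n i k < n.
Proof. by rewrite /push; case: ifP; lia. Qed.

Lemma pushK n i k : k <= n -> i < n -> pull n (push n i k) k = i.
Proof. by move=> k_n i_n; rewrite /push /pull; case: (leqP k i); case: ifP; lia. Qed.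

(** Positions are natural numbers so that [lia] can do the bookkeeping; they count from 0, letters
    count from 1, and a position past the end reads 0. *)
Definition letter n (p : 'S_n) i := nth 0 (oneline p) i.

Lemma letterE n (p : 'S_n) (i : 'I_n) : letter p i = (p i).+1.
Proof. by rewrite /letter (nth_map i) ?size_enum_ord // nth_ord_enum. Qed.

Lemma letter_bounds n (p : 'S_n) i : i < n -> 0 < letter p i <= n.
Proof. by move=> i_n; rewrite -[i]/(val (Ordinal i_n)) letterE /=. Qed.

Lemma letter_inj n (p : 'S_n) i j : i < n -> j < n -> letter p i = letter p j -> i = j.
Proof.
move=> i_n j_n; rewrite -[i]/(val (Ordinal i_n)) -[j]/(val (Ordinal j_n)).
by rewrite !letterE => -[] /val_inj /perm_inj [].
Qed.

Lemma letter_ext n (p q : 'S_n) : (forall i, i < n -> letter p i = letter q i) -> p = q.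
Proof.
move=> eq_pq; apply/permP => i; apply/val_inj.
by have := eq_pq i (ltn_ord i); rewrite !letterE => -[].
Qed.

Lemma letter_topdrop n (p : 'S_n) i : i < n ->
  letter (topdrop p) i = letter p (pull n i (letter p 0)).
Proof.
move=> i_n; have lt := pull_lt (letter p 0) i_n.
rewrite -[i in LHS]/(val (Ordinal i_n)) -[pull _ _ _]/(val (Ordinal lt)) !letterE.
rewrite permM permE; congr (val (p _)).+1; apply/val_inj.
by rewrite /= val_topdrop_pos -nth0.
Qed.

Lemma letter_push n (p : 'S_n) i : i < n ->
  letter (topdrop p) (push n i (letter p 0)) = letter p i.
Proof.
move=> i_n; rewrite letter_topdrop ?push_lt // pushK //.
by case/andP: (letter_bounds p (leq_ltn_trans (leq0n i) i_n)).
Qed.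

(** * Reversal and palindromic orbits *)

Definition reverse n (p : 'S_n) : 'S_n := (perm (@rev_ord_inj n) * p)%g.

Lemma letter_reverse n (p : 'S_n) i : i < n -> letter (reverse p) i = letter p (n - i.+1).
Proof.
move=> i_n; have lt : n - i.+1 < n by lia.
rewrite -[i in LHS]/(val (Ordinal i_n)) -[n - _]/(val (Ordinal lt)) !letterE.
by rewrite permM permE; congr (val (p _)).+1; apply/val_inj.
Qed.

Lemma reverseK n : involutive (@reverse n).
Proof.
move=> p; apply: letter_ext => i i_n.
by rewrite !letter_reverse; [congr letter|..]; lia.
Qed.

Lemma reverse_neq n (p : 'S_n) : 1 < n -> reverse p <> p.
Proof.
move=> n_gt1 /(congr1 (fun q : 'S_n => letter q 0)); rewrite letter_reverse; last by lia.
by move/letter_inj; lia.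
Qed.

(** With k the head of p, R T p starts with the first k letters of p in their original order, so the
    next move has the same head and lays this block down reversed at the end. *)
Lemma topdrop_reverse n (p : 'S_n) : topdrop (reverse (topdrop p)) = reverse p.
Proof.
apply: letter_ext => i i_n; have n_gt0 : 0 < n by lia.
have /andP[k_gt0 k_n] := letter_bounds p n_gt0.
have Dk : letter (reverse (topdrop p)) 0 = letter p 0.
  by rewrite letter_reverse // letter_topdrop ?/pull; [congr letter; case: ifP|]; lia.
have lt := pull_lt (letter p 0) i_n.
rewrite letter_topdrop // Dk !letter_reverse // letter_topdrop; last by lia.
by congr letter; rewrite /pull; case: ifP; case: ifP; lia.
Qed.

Lemma iter_topdrop_reverse n (p : 'S_n) j :
  iter j (@topdrop n) (reverse (iter j (@topdrop n) p)) = reverse p.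
Proof. by elim: j p => // j IH p; rewrite iterSr iterS topdrop_reverse IH. Qed.

Lemma topdrop_eq_reverse n (p : 'S_n) : 1 < n ->
  (topdrop p == reverse p) = (n.-1 <= letter p 0).
Proof.
move=> n_gt1; have n_gt0 := ltnW n_gt1; have /andP[k_gt0 k_n] := letter_bounds p n_gt0.
apply/eqP/idP => [/(congr1 (fun q : 'S_n => letter q 0)) | k_ge].
  rewrite letter_topdrop // letter_reverse // => /letter_inj.
  by rewrite pull_lt // /pull; case: ifP; lia.
apply: letter_ext => i i_n; rewrite letter_topdrop // letter_reverse //.
by congr letter; rewrite /pull; case: ifP; lia.
Qed.

(** Since T q = R q, T^(m+1) q = T^m R T^m (T p) = R (T p) = R (R p) = p. *)
Lemma iter_topdrop_palindrome n (p : 'S_n) m (q := iter m.+1 (@topdrop n) p) : 1 < n ->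
  n.-1 <= letter p 0 -> n.-1 <= letter q 0 -> iter (m.+1).*2 (@topdrop n) p = p.
Proof.
move=> n_gt1; rewrite -!topdrop_eq_reverse // => /eqP Tp /eqP Tq.
rewrite -addnn iterD -/q iterSr Tq /q iterSr iter_topdrop_reverse Tp.
exact: reverseK.
Qed.

(** If T p = R p and s = 2m + 1, then T^(m+1) p = T^m (R p) is the reversal of T^(m+1) p, which no
    permutation of at least two letters allows. *)
Lemma odd_period_letter n (p : 'S_n) s : 1 < n -> odd s ->
  iter s (@topdrop n) p = p -> letter p 0 < n.-1.
Proof.
move=> n_gt1 odd_s per; rewrite ltnNge -topdrop_eq_reverse //; apply/eqP => Tp.
have [m Ds] : exists m, s = m + m.+1 by exists s./2; lia.
have := iter_topdrop_reverse (iter m.+1 (@topdrop n) p) m.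
rewrite -iterD -Ds per -Tp -iterSr => /esym; exact: reverse_neq.
Qed.

(** * Head sequences and the permutations that realize them *)

Fixpoint heads n s (p : 'S_n) : seq nat :=
  if s is s'.+1 then letter p 0 :: heads s' (topdrop p) else [::].

Lemma size_heads n s (p : 'S_n) : size (heads s p) = s.
Proof. by elim: s p => //= s IH p; rewrite IH. Qed.

Lemma nth_heads n s (p : 'S_n) j : j < s ->
  nth 0 (heads s p) j = letter (iter j (@topdrop n) p) 0.
Proof. by elim: s p j => // s IH p [|j] //= /IH ->; rewrite -iterSr. Qed.

(* The positions in p of the successive heads l. *)
Fixpoint head_pos n (l : seq nat) : seq nat :=
  if l is a :: l' then 0 :: [seq pull n i a | i <- head_pos n l'] else [::].

Lemma size_head_pos n l : size (head_pos n l) = size l.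
Proof. by elim: l => //= a l IH; rewrite size_map IH. Qed.

Lemma head_pos_lt n l i : 0 < n -> i \in head_pos n l -> i < n.
Proof.
move=> n_gt0; elim: l i => //= a l IH i; rewrite inE => /predU1P[-> //|].
by case/mapP => j /IH j_n ->; apply: pull_lt.
Qed.

(** Once the first head is known to be a, the letters of [topdrop p] are read in p through
    [pull n _ a], and the remaining heads follow by induction. *)
Lemma headsE n (p : 'S_n) l : 0 < n ->
  (heads (size l) p == l) = ([seq letter p i | i <- head_pos n l] == l).
Proof.
move=> n_gt0; elim: l p => //= a l IH p; rewrite !eqseq_cons.
case: eqP => //= Da; rewrite IH -map_comp; congr (_ == _).
apply/eq_in_map => i /(head_pos_lt n_gt0) i_n /=.
by rewrite letter_topdrop // Da.
Qed.

Lemma letter_iter_pull n s (p : 'S_n) i : i < n ->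
  letter (iter s (@topdrop n) p) i = letter p (foldr (fun a j => pull n j a) i (heads s p)).
Proof.
move=> i_n; elim: s p => //= s IH p; rewrite -iterS iterSr IH letter_topdrop //.
by elim: heads => //= a l; apply: pull_lt.
Qed.

Lemma letter_iter_push n s (p : 'S_n) i : i < n ->
  letter (iter s (@topdrop n) p) (foldl (push n) i (heads s p)) = letter p i.
Proof.
elim: s p i => //= s IH p i i_n; rewrite -iterS iterSr IH ?push_lt //.
exact: letter_push.
Qed.

(** This is what makes l prescribe d distinct letters at d distinct positions. *)
Definition good_itinerary n d l :=
  [&& size l == d, uniq l, all (fun a => 0 < a <= n) l & uniq (head_pos n l)].

Lemma card_heads n d l : 0 < n -> good_itinerary n d l ->
  #|[set p : 'S_n | heads d p == l]| = (n - d)`!.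
Proof.
move=> n_gt0 /and4P[/eqP <- ul /allP bl upos].
have valI (s : seq nat) : {in s, forall i, i < n} -> map val (pmap insub s : seq 'I_n) = s.
  move=> lt_s; rewrite pmap_filter; last exact: insubK.
  by apply/all_filterP/allP => i /lt_s; rewrite isSome_insub.
pose s := pmap insub (head_pos n l) : seq 'I_n.
pose t := pmap insub (map predn l) : seq 'I_n.
have Ds : map val s = head_pos n l by apply: valI => i; exact: head_pos_lt.
have Dt : map val t = map predn l.
  by apply: valI => _ /mapP[a /bl a_n ->]; lia.
have sz : size s = size l by rewrite -(size_map val) Ds size_head_pos.
rewrite -[in RHS]sz -(@card_perm_prescribed n s t).
- apply: eq_card => p; rewrite !inE headsE // -Ds.
  have -> : l = [seq (val i).+1 | i <- t].
    rewrite (map_comp S val) Dt -map_comp -[LHS]map_id.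
    by apply/eq_in_map => a /bl; case: a.
  have -> : [seq letter p i | i <- map val s] = [seq (val i).+1 | i <- map p s].
    by rewrite -!map_comp; apply: eq_map => i /=; rewrite letterE.
  by rewrite (inj_eq (inj_map _)) // => i j [] /val_inj.
- by rewrite -(map_inj_uniq val_inj) Ds.
- rewrite -(map_inj_uniq val_inj) Dt map_inj_in_uniq // => a b /bl a_gt0 /bl b_gt0; lia.
by rewrite -(size_map val) Ds -[RHS](size_map val) Dt size_map size_head_pos.
Qed.

Lemma card_heads_in n d (L : seq (seq nat)) : 0 < n -> uniq L ->
  all (good_itinerary n d) L -> #|[set p : 'S_n | heads d p \in L]| = size L * (n - d)`!.
Proof.
move=> n_gt0; elim: L => [_ _|l L IH /= /andP[lL uL] /andP[gl gL]].
  by apply: eq_card0 => p; rewrite inE.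
rewrite mulSn -IH // -(card_heads n_gt0 gl) -cardsUI [X in _ + X]eq_card0 ?addn0.
  by apply: eq_card => p; rewrite !inE.
by move=> p; rewrite !inE; case: eqP => // ->; rewrite (negPf lL).
Qed.

(** * Exact periods and orbit counts *)

Definition exact_period n s (p : 'S_n) :=
  iter s (@topdrop n) p = p /\ forall j, 0 < j < s -> iter j (@topdrop n) p <> p.

Lemma iter_topdrop_perm n j (p : 'S_n) : iter j (topdrop_perm n) p = iter j (@topdrop n) p.
Proof. by apply: eq_iter => q; rewrite permE. Qed.

Lemma exact_period_porbit n (p : 'S_n) :
  exact_period #|porbit (topdrop_perm n) p| p.
Proof.
split=> [|j /andP[j_gt0 j_lt]]; first by rewrite -iter_topdrop_perm iter_porbit.
have /(_ j 0) := uniqP p (uniq_traject_porbit (topdrop_perm n) p).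
rewrite !inE size_traject j_lt (ltn_trans j_gt0 j_lt) => /(_ isT isT).
by rewrite !nth_traject ?(ltn_trans j_gt0) // iter_topdrop_perm /=
  => inj /inj j0; rewrite j0 in j_gt0.
Qed.

Lemma num_orbits_leqif n s (F : {set 'S_n}) : 0 < s ->
  {in F, forall p, iter s (@topdrop n) p = p} ->
  {in F, forall p j, 0 < j < s -> iter j (@topdrop n) p \notin F} ->
  #|F| <= num_orbits n s
    ?= iff [forall p, (#|porbit (topdrop_perm n) p| == s) ==>
                      [exists q in porbit (topdrop_perm n) p, q \in F]].
Proof.
move=> s_gt0 perF freeF; apply: card_orbits_le => // p Fp.
  by rewrite iter_topdrop_perm perF.
by move=> j j_s; rewrite iter_topdrop_perm freeF.
Qed.

Lemma num_orbits_ge n s (F : {set 'S_n}) : 0 < s ->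
  {in F, forall p, iter s (@topdrop n) p = p} ->
  {in F, forall p j, 0 < j < s -> iter j (@topdrop n) p \notin F} ->
  #|F| <= num_orbits n s.
Proof. by move=> s_gt0 perF freeF; rewrite (num_orbits_leqif s_gt0 perF freeF). Qed.

(** The last hypothesis is the equality case of the orbit count, phrased for permutations of exact
    period s. *)
Lemma num_orbitsE n s (F : {set 'S_n}) : 0 < s ->
  {in F, forall p, iter s (@topdrop n) p = p} ->
  {in F, forall p j, 0 < j < s -> iter j (@topdrop n) p \notin F} ->
  (forall p, exact_period s p -> exists j, iter j (@topdrop n) p \in F) ->
  num_orbits n s = #|F|.
Proof.
move=> s_gt0 perF freeF hitF; apply/esym/eqP.
rewrite (num_orbits_leqif s_gt0 perF freeF); apply/forallP => p; apply/implyP => /eqP sz.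
have [j Fj] := hitF p (eq_ind _ (fun k => exact_period k p) (exact_period_porbit p) _ sz).
apply/existsP; exists (iter j (@topdrop n) p); rewrite Fj andbT.
by rewrite -iter_topdrop_perm -permX mem_porbit.
Qed.

Lemma exact_period_iter n s (p : 'S_n) j :
  exact_period s p -> exact_period s (iter j (@topdrop n) p).
Proof.
case=> per min; split=> [|i i_s].
  by rewrite -iterD addnC iterD per.
rewrite -iterD addnC iterD => eq; apply: (min i i_s).
by elim: j eq => //= j IH /topdrop_inj.
Qed.

(** * Relations between successive heads *)

Lemma letter_topdrop_last n (p : 'S_n) : 0 < n -> letter (topdrop p) n.-1 = letter p 0.
Proof.
move=> n_gt0; have /andP[k_gt0 k_n] := letter_bounds p n_gt0.
by rewrite letter_topdrop; [congr letter; rewrite /pull; case: ifP|]; lia.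
Qed.

Lemma head_topdrop_neq n (p : 'S_n) : 1 < n -> letter (topdrop p) 0 <> letter p 0.
Proof.
move=> n_gt1; have n_gt0 := ltnW n_gt1; have /andP[k_gt0 k_n] := letter_bounds p n_gt0.
rewrite letter_topdrop // => /letter_inj; rewrite pull_lt // => /(_ isT n_gt0).
by rewrite /pull; case: ifP; lia.
Qed.

(** The head of p is the last letter of [topdrop p], and the last letter comes to the front only
    under a head n - 1 or n. *)
Lemma head_topdrop2_eq n (p : 'S_n) :
  letter (topdrop (topdrop p)) 0 = letter p 0 -> n.-1 <= letter (topdrop p) 0.
Proof.
case: leqP => // k'_lt; have n_gt0 : 0 < n by lia.
have /andP[k_gt0 k_n] := letter_bounds p n_gt0.
have /andP[k'_gt0 _] := letter_bounds (topdrop p) n_gt0.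
rewrite letter_topdrop // letter_topdrop ?pull_lt // => /letter_inj.
rewrite !pull_lt // => /(_ isT n_gt0).
by rewrite /pull; case: ifP; case: ifP; lia.
Qed.

Lemma palindrome_iter n s (p : 'S_n) k : 1 < n -> n.-1 <= letter p 0 ->
  iter s (@topdrop n) p = p -> k <= s ->
  iter k.+1 (@topdrop n) p = reverse (iter (s - k) (@topdrop n) p).
Proof.
move=> n_gt1 k_ge per k_s; move: k_ge; rewrite -topdrop_eq_reverse // => /eqP Tp.
by rewrite -(iter_topdrop_reverse _ k) -iterD subnKC // per iterSr Tp.
Qed.

(** The last letter of T^(k+1) p is the head of T^k p; as T^(k+1) p is the reversal of T^(s-k) p, it
    is also the head of the latter. *)
Lemma palindrome_head n s (p : 'S_n) k : 1 < n -> n.-1 <= letter p 0 ->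
  iter s (@topdrop n) p = p -> k <= s ->
  letter (iter (s - k) (@topdrop n) p) 0 = letter (iter k (@topdrop n) p) 0.
Proof.
move=> n_gt1 k_ge per k_s; have := palindrome_iter n_gt1 k_ge per k_s.
move/(congr1 (fun q : 'S_n => letter q n.-1)); rewrite letter_topdrop_last; last by lia.
by rewrite letter_reverse ?prednK ?subnn //; lia.
Qed.

(** * Orbits of size two *)

Lemma num_orbits2 n : 2 <= n -> num_orbits n 2 = (n - 2)`!.
Proof.
move=> n_ge2; have n_gt0 := ltnW n_ge2.
(* Both heads of a two-cycle are at least n - 1 and they differ; the element with head n represents
   the orbit. *)
rewrite -(@card_heads n 2 [:: n; n.-1]) //; last first.
  by rewrite /good_itinerary /= !inE /pull; case: ifP; lia.
apply: num_orbitsE => // [p|p|p [per min]].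
- rewrite inE /= => /eqP[Dp Dq]; apply: (@iter_topdrop_palindrome n p 0) => //=; lia.
- rewrite inE /= => /eqP[Dp Dq] [|[|j]] //= _; rewrite inE /= !eqseq_cons Dq; lia.
rewrite /= in per; have q_big := head_topdrop2_eq (congr1 (fun q : 'S_n => letter q 0) per).
have p_big : n.-1 <= letter p 0 by rewrite -per; apply: head_topdrop2_eq; rewrite per.
have := head_topdrop_neq (p := p) n_ge2 => neq_pq.
have := letter_bounds p n_gt0 => p_n; have := letter_bounds (topdrop p) n_gt0 => q_n.
have [Dp|Dp] := eqVneq (letter p 0) n.
  by exists 0; rewrite inE /= !eqseq_cons eqxx; lia.
by exists 1; rewrite inE /= per !eqseq_cons eqxx; lia.
Qed.

(** * Following a letter around a period *)

Lemma foldl_push_lt n i l : i < n -> foldl (push n) i l < n.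
Proof. by elim: l i => //= a l IH i i_n; rewrite IH ?push_lt. Qed.

Lemma period_foldl n s (p : 'S_n) i : iter s (@topdrop n) p = p -> i < n ->
  foldl (push n) i (heads s p) = i.
Proof.
move=> per i_n; apply: (@letter_inj n p) => //; first exact: foldl_push_lt.
by rewrite -[RHS](letter_iter_push s p i_n) per.
Qed.

(** With period s + 2 the last letter of p is the head of T^(s+1) p. In T^s p that letter stands at
    0-based position k, where k is the head of T^s p. *)
Lemma period_last n s (p : 'S_n) : iter s.+2 (@topdrop n) p = p ->
  letter (iter s (@topdrop n) p) 0 < n ->
  foldl (push n) n.-1 (heads s p) = letter (iter s (@topdrop n) p) 0.
Proof.
move=> per k_n; have n_gt0 : 0 < n by lia.
apply: (@letter_inj n (iter s (@topdrop n) p)) => //; first by apply: foldl_push_lt; lia.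
rewrite letter_iter_push; last by lia.
rewrite -[in LHS]per iterS letter_topdrop_last // iterS letter_topdrop //.
by congr letter; rewrite /pull add0n k_n.
Qed.

(* In the next three lemmas the letters at positions n - 1 and a - 1 become
   neighbours at positions n - 1 - a and n - a after the first move, and they
   are followed until they return to their original positions. *)
Lemma no_loop3 n a b c : 0 < a < n.-1 -> 0 < b < n.-1 -> 0 < c < n.-1 -> a <> c ->
  foldl (push n) n.-1 [:: a] = b -> foldl (push n) n.-1 [:: a; b; c] = n.-1 ->
  foldl (push n) a.-1 [:: a; b; c] = a.-1 -> False.
Proof.
move=> a_n b_n c_n ac /= Eb Eu Ev; move: Eb Eu Ev.
have -> : push n n.-1 a = n.-1 - a by rewrite /push; case: ifP; lia.
have -> : push n a.-1 a = n - a by rewrite /push; case: ifP; lia.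
move=> Eb; have -> : push n (n.-1 - a) b = 0 by rewrite /push; case: ifP; lia.
have -> : push n (n - a) b = 1 by rewrite /push; case: ifP; lia.
by rewrite /push; case: ifP; case: ifP; lia.
Qed.

Lemma cut4 n a b c d :
  0 < a < n.-1 -> 0 < b < n.-1 -> 0 < c < n.-1 -> 0 < d < n.-1 -> a <> d -> a <> c ->
  foldl (push n) n.-1 [:: a; b] = c -> foldl (push n) n.-1 [:: a; b; c; d] = n.-1 ->
  foldl (push n) a.-1 [:: a; b; c; d] = a.-1 -> a + b = n.
Proof.
move=> a_n b_n c_n d_n ad ac /=.
have -> : push n n.-1 a = n.-1 - a by rewrite /push; case: ifP; lia.
have -> : push n a.-1 a = n - a by rewrite /push; case: ifP; lia.
move=> Ec; rewrite Ec; have -> : push n c c = 0 by rewrite /push; case: ifP; lia.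
have -> : push n 0 d = n.-1 by rewrite /push; case: ifP; lia.
by move: Ec; rewrite /push; do !case: ifP; lia.
Qed.

Lemma cut5 n a b c d e :
  0 < a < n.-1 -> 0 < b < n.-1 -> 0 < c < n.-1 -> 0 < d < n.-1 -> 0 < e < n.-1 -> a <> e ->
  foldl (push n) n.-1 [:: a; b; c] = d -> foldl (push n) n.-1 [:: a; b; c; d; e] = n.-1 ->
  foldl (push n) a.-1 [:: a; b; c; d; e] = a.-1 ->
  [\/ a + b = n, a + b + c = n, n < a + b /\ a = c + d
    | [/\ a + b < n, n < a + b + c & d = a + b]].
Proof.
move=> a_n b_n c_n d_n e_n ae /=.
have -> : push n n.-1 a = n.-1 - a by rewrite /push; case: ifP; lia.
have -> : push n a.-1 a = n - a by rewrite /push; case: ifP; lia.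
move=> Ed; rewrite Ed; have -> : push n d d = 0 by rewrite /push; case: ifP; lia.
have -> : push n 0 e = n.-1 by rewrite /push; case: ifP; lia.
move=> _; have [?|abn] := eqVneq (a + b) n; first by constructor 1.
have [?|abcn] := eqVneq (a + b + c) n; first by constructor 2.
have [ab_lt|ab_gt] := ltnP (a + b) n.
  have E1 : push n (n.-1 - a) b = n.-1 - a - b by rewrite /push; case: ifP; lia.
  have E2 : push n (n - a) b = n - a - b by rewrite /push; case: ifP; lia.
  rewrite E2; rewrite E1 in Ed; move: Ed.
  rewrite {1 4}/push; case: ifP; case: ifP; try lia; rewrite /push.
    (* Here the pair stands at positions d and d + 1 before the fourth move. The second letter then
       goes to position 1, and the last move cannot bring it to a - 1, since a differs from e and a
       < n - 1. *)
    by do !case: ifP; lia.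
  by move=> *; constructor 4; split; lia.
have E1 : push n (n.-1 - a) b = a by rewrite /push; case: ifP; lia.
have E2 : push n (n - a) b = a.-1 by rewrite /push; case: ifP; lia.
rewrite E2; rewrite E1 in Ed; move: Ed.
rewrite {1 4}/push; case: ifP; case: ifP; try lia; rewrite /push.
  by move=> *; constructor 3; split; lia.
by do !case: ifP; lia.
Qed.

(** The letter at position a - 1 passes through n - a, n - a - b, a + b - 1, n - a - b and arrives
    at 0, so a - 1 = 0. *)
Lemma final5 n a b c d e :
  0 < a < n.-1 -> 0 < b < n.-1 -> b + c = n -> d = a + b -> d + e = n -> 
  foldl (push n) a.-1 [:: a; b; c; d; e] = a.-1 -> a = 1.
Proof.
move=> a_n b_n bc Dd de /=.
have -> : push n a.-1 a = n - a by rewrite /push; case: ifP; lia.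
have -> : push n (n - a) b = n - a - b by rewrite /push; case: ifP; lia.
have -> : push n (n - a - b) c = a + b.-1 by rewrite /push; case: ifP; lia.
have -> : push n (a + b.-1) d = n - a - b by rewrite /push; case: ifP; lia.
by rewrite /push; case: ifP; lia.
Qed.

(** * Orbits of size three *)

Lemma num_orbits3 n : num_orbits n 3 = 0.
Proof.
rewrite (@num_orbitsE n 3 set0) ?cards0 // => [p|p|p [per min]]; rewrite ?inE //.
case: (ltnP 1 n) => [n_gt1 | n_le1]; last first.
  (* For n at most 1 there is a single permutation, so the period is one. *)
  case: (min 1 isT); apply: letter_ext => i i_n.
  have := letter_bounds p i_n; have := letter_bounds (topdrop p) i_n; rewrite /=; lia.
have n_gt0 := ltnW n_gt1.
have iter_n j : letter (iter j (@topdrop n) p) 0 < n.-1.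
  by apply: (@odd_period_letter _ _ 3) => //; rewrite -iterD addnC iterD per.
have bounds j : 0 < letter (iter j (@topdrop n) p) 0 < n.-1.
  by rewrite iter_n; case/andP: (letter_bounds (iter j (@topdrop n) p) n_gt0) => ->.
have lt_n j : letter (iter j (@topdrop n) p) 0 < n by have := iter_n j; lia.
case: (@no_loop3 n _ _ _ (bounds 0) (bounds 1) (bounds 2)).
- by have := @head_topdrop_neq n (iter 2 (@topdrop n) p) n_gt1; rewrite -iterS per.
- exact: period_last (lt_n 1).
- by apply: (period_foldl (s := 3)) => //; lia.
by apply: (period_foldl (s := 3)) => //; have := lt_n 0; rewrite /=; lia.
Qed.

(** * Orbits of size four *)

(** The fourth head is again x by the palindrome, so three heads are prescribed; the n - 2 choices
    of x give (n - 2) (n - 3)! = (n - 2)! permutations. *)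
Definition itineraries4 n := [seq [:: n; x; n.-1] | x <- iota 1 (n - 2)].

Lemma itineraries4P n (p : 'S_n) : 2 <= n -> reflect
  (exists2 x, 0 < x < n.-1 & [/\ letter p 0 = n, letter (topdrop p) 0 = x
     & letter (topdrop (topdrop p)) 0 = n.-1]) (heads 3 p \in itineraries4 n).
Proof.
move=> n_ge2; apply: (iffP mapP) => [[x] | [x x_n [Dp Dx Dq]]].
  by rewrite mem_iota => x_n /= [-> -> ->]; exists x => //; lia.
by exists x; [rewrite mem_iota; lia | rewrite /= Dp Dx Dq].
Qed.

Lemma num_orbits4 n : 3 <= n -> num_orbits n 4 = (n - 2)`!.
Proof.
move=> n_ge3; have n_gt1 : 1 < n by lia.
have n_gt0 := ltnW n_gt1.
pose F := [set p : 'S_n | heads 3 p \in itineraries4 n].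
have F_per : {in F, forall p, iter 4 (@topdrop n) p = p}.
  move=> p; rewrite inE => /(itineraries4P _ n_gt1)[x _ [Dp _ Dq]].
  by apply: (@iter_topdrop_palindrome n p 1) => //=; lia.
rewrite (@num_orbitsE n 4 F) //.
- rewrite card_heads_in //.
  + by rewrite size_map size_iota (_ : n - 2 = (n - 3).+1) ?factS //; lia.
  + by rewrite map_inj_uniq ?iota_uniq // => x y [].
  apply/allP => _ /mapP[x /[!mem_iota] x_n ->].
  by rewrite /good_itinerary /= !inE /pull; do !case: ifP; lia.
- move=> p Fp j j_4; have per := F_per p Fp.
  move: Fp; rewrite inE => /(itineraries4P _ n_gt1)[x x_n [Dp Dx Dq]].
  rewrite inE; apply/(itineraries4P _ n_gt1) => -[y _ [D0 _ _]]; move: D0.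
  case: j j_4 => [|[|[|[|j]]]] //= _; try lia.
  have /= -> := @palindrome_head n 4 p 1 n_gt1 _ per isT; lia.
move=> p per_p.
have [[j big_j] | /(_ _)small] : (exists j, n.-1 <= letter (iter j (@topdrop n) p) 0) \/
    (forall j, letter (iter j (@topdrop n) p) 0 < n.-1).
  have [|small] := boolP [exists j : 'I_4, n.-1 <= letter (iter j (@topdrop n) p) 0].
    by case/existsP => j; left; exists (val j).
  right=> j; have : iter j (@topdrop n) p = iter (j %% 4) (@topdrop n) p.
    rewrite {1}(divn_eq j 4) addnC iterD; congr iter.
    by elim: (j %/ 4) => // i IH; rewrite mulSn iterD IH per_p.1.
  move->; rewrite ltnNge; apply: contra small => big.
  by apply/existsP; exists (Ordinal (ltn_pmod j (isT : 0 < 4))).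
- have := exact_period_iter j per_p; set q := iter j _ p => per_q.
  rewrite -/q in big_j.
  have [per min] := per_q.
  have /= D3 := @palindrome_iter n 4 q 2 n_gt1 big_j per isT.
  have /= D1 := @palindrome_head n 4 q 1 n_gt1 big_j per isT.
  move/eqP: D3; rewrite topdrop_eq_reverse // => big2.
  have Tq : topdrop q = reverse q by apply/eqP; rewrite topdrop_eq_reverse.
  have small1 : letter (topdrop q) 0 < n.-1.
    rewrite ltnNge -topdrop_eq_reverse //; apply/eqP => TTq.
    by apply: (min 2) => //=; rewrite TTq Tq reverseK.
  (* The head between them is small, so the two large heads differ: one is n and the other n - 1. *)
  have neq : letter (topdrop (topdrop q)) 0 <> letter q 0 by move/head_topdrop2_eq; lia.
  have b0 := letter_bounds q n_gt0; have b2 := letter_bounds (topdrop (topdrop q)) n_gt0.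
  have b1 := letter_bounds (topdrop q) n_gt0.
  rewrite /= in per; have [Dq|Dq] := eqVneq (letter q 0) n.
    exists j; rewrite -/q inE; apply/itineraries4P => //.
    by exists (letter (topdrop q) 0); [lia | split=> //; lia].
  exists (2 + j); rewrite iterD -/q inE; apply/itineraries4P => //.
  by exists (letter (topdrop q) 0); [lia | split=> //=; rewrite ?per; lia].
have [per min] := per_p.
have per_j j : iter 4 (@topdrop n) (iter j (@topdrop n) p) = iter j (@topdrop n) p.
  by rewrite -iterD addnC iterD per.
have bounds j : 0 < letter (iter j (@topdrop n) p) 0 < n.-1.
  by rewrite small; case/andP: (letter_bounds (iter j (@topdrop n) p) n_gt0) => ->.
have neq1 j : letter (iter j.+1 (@topdrop n) p) 0 <> letter (iter j (@topdrop n) p) 0.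
  exact: head_topdrop_neq.
have neq2 j : letter (iter j.+2 (@topdrop n) p) 0 <> letter (iter j (@topdrop n) p) 0.
  by move/head_topdrop2_eq; rewrite leqNgt (small j.+1).
(* With no large head, any two consecutive heads sum to n. Heads two apart would then be equal,
   against [neq2]. *)
have cut j : letter (iter j (@topdrop n) p) 0 + letter (iter j.+1 (@topdrop n) p) 0 = n.
  apply: (@cut4 n _ _ _ _ (bounds j) (bounds j.+1) (bounds j.+2) (bounds j.+3)).
  + by have := neq1 j.+3; rewrite -[j.+4]/(4 + j) iterD per_j.
  + by move/esym; exact: neq2.
  + by apply: (period_last (per_j j)); apply: (leq_trans (small j.+2)); lia.
  + by apply: (period_foldl (per_j j)); lia.
  by apply: (period_foldl (per_j j)); have := bounds j; lia.
by have := neq2 0; have := cut 0; have := cut 1; lia.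
Qed.

(** * Orbits of size five *)

Lemma pullP n i k :
  (i + k < n /\ pull n i k = i + k) \/ (n <= i + k /\ pull n i k = n - i.+1).
Proof. by rewrite /pull; case: ltnP; [left | right]. Qed.

(* Innermost first, so that lia can discard branches before they multiply. *)
Ltac eval_pull :=
  repeat match goal with |- context [pull ?n ?i ?k] =>
    lazymatch i with context [pull _ _ _] => fail | _ => idtac end;
    let lt := fresh "lt" in case: (pullP n i k) => -[lt ->]; try (exfalso; lia)
  end.

(** The range of b keeps the head 1 different from the others; the three inequations keep the other
    four heads distinct from each other. *)
Definition itineraries5 n :=
  [seq [:: 1; n - b.+1; b.+1; n - b; b] | b <- iota 2 (n - 4) &
     (b.*2 != n - 2) && (b.*2 != n.-1) && (b.*2 != n)].

(** Every rotation of the five heads satisfies one of the four alternatives of [cut5]. Linear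
    arithmetic refutes all combinations except those giving, up to rotation, b + c = n, d = a + b, d
    + e = n; refuting partial combinations early limits the number of cases. *)
Lemma cyclic_cuts5 n a b c d e :
  let cut a b c d := [\/ a + b = n, a + b + c = n, n < a + b /\ a = c + d
    | [/\ a + b < n, n < a + b + c & d = a + b]] in
  0 < a < n.-1 -> 0 < b < n.-1 -> 0 < c < n.-1 -> 0 < d < n.-1 -> 0 < e < n.-1 ->
  a <> b ->
  cut a b c d -> cut b c d e -> cut c d e a -> cut d e a b -> cut e a b c ->
  let final a b c d e := [/\ b + c = n, d = a + b & d + e = n] in
  [\/ final a b c d e, final b c d e a, final c d e a b
    | final d e a b c \/ final e a b c d].
Proof.
move=> cut a_n b_n c_n d_n e_n ab c1 c2 c3 c4 c5 final.
case: c1 => [?|?|[? ?]|[? ? ?]]; case: c2 => [?|?|[? ?]|[? ? ?]]; try (exfalso; lia);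
case: c3 => [?|?|[? ?]|[? ? ?]]; try (exfalso; lia);
case: c4 => [?|?|[? ?]|[? ? ?]]; try (exfalso; lia);
case: c5 => [?|?|[? ?]|[? ? ?]]; try (exfalso; lia);
first [ constructor 1; split; lia | constructor 2; split; lia | constructor 3; split; lia
 | constructor 4; left; split; lia | constructor 4; right; split; lia].
Qed.

(** Of the n - 4 values of b, odd n excludes only (n - 1)/2, while even n excludes n/2 - 1 and
    n/2. *)
Lemma size_itineraries5 n : 7 <= n ->
  size (itineraries5 n) = if odd n then n - 5 else n - 6.
Proof.
move=> n_ge7; rewrite size_map size_filter.
set P := (P in count P _).
have <- : n - 4 - count (predC P) (iota 2 (n - 4)) = count P (iota 2 (n - 4)).
  by rewrite -{1}(size_iota 2 (n - 4)) -(count_predC P) addnK.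
rewrite -size_filter; case: ifP => odd_n.
  rewrite (perm_size (_ : perm_eq _ [:: n./2])) /=; first by lia.
  apply: uniq_perm => // [|b]; first by rewrite filter_uniq ?iota_uniq.
  by rewrite mem_filter mem_iota !inE /P /=; lia.
rewrite (perm_size (_ : perm_eq _ [:: n./2.-1; n./2])) /=; first by lia.
apply: uniq_perm => [||b]; first by rewrite filter_uniq ?iota_uniq.
  by rewrite /= inE; lia.
by rewrite mem_filter mem_iota !inE /P /=; lia.
Qed.

Lemma num_orbits5 n : 7 <= n ->
  num_orbits n 5 = (if odd n then n - 5 else n - 6) * (n - 5)`!.
Proof.
move=> n_ge7; have n_gt1 : 1 < n by lia.
have n_gt0 := ltnW n_gt1.
rewrite -size_itineraries5 // -card_heads_in //; last first.
- apply/allP => l /mapP[b]; rewrite mem_filter mem_iota => b_n ->.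
  rewrite /good_itinerary /= !inE; eval_pull; lia.
- by rewrite map_inj_uniq ?filter_uniq ?iota_uniq // => x y [].
apply: num_orbitsE => //.
- move=> p; rewrite inE => /mapP[b]; rewrite mem_filter mem_iota => b_n Dp.
  apply: letter_ext => i i_n; rewrite letter_iter_pull // Dp /=.
  by congr letter; eval_pull; lia.
- move=> p; rewrite inE => /mapP[b]; rewrite mem_filter mem_iota => b_n Dp j j_5.
  (* The head 1 occurs only once in the itinerary, so it singles out one element of the orbit. *)
  rewrite inE; apply/mapP => -[c _ Dq].
  have Dj : letter (iter j (@topdrop n) p) 0 = 1 by case: Dq.
  rewrite -(nth_heads p (proj2 (andP j_5))) Dp in Dj.
  by case: j j_5 {Dq} Dj => [|[|[|[|[|j]]]]] //=; lia.
move=> p [per min].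
have small j : letter (iter j (@topdrop n) p) 0 < n.-1.
  by apply: (@odd_period_letter _ _ 5) => //; rewrite -iterD addnC iterD per.
have per_j j : iter 5 (@topdrop n) (iter j (@topdrop n) p) = iter j (@topdrop n) p.
  by rewrite -iterD addnC iterD per.
pose a j := letter (iter j (@topdrop n) p) 0.
have a5 j : a (5 + j) = a j by rewrite /a iterD per_j.
have bounds j : 0 < a j < n.-1.
  by rewrite /a small; case/andP: (letter_bounds (iter j (@topdrop n) p) n_gt0) => ->.
have neq1 j : a j.+1 <> a j by exact: head_topdrop_neq.
have neq2 j : a j.+2 <> a j.
  by move/head_topdrop2_eq; rewrite leqNgt (small j.+1).
have hds j : heads 5 (iter j (@topdrop n) p) = [:: a j; a j.+1; a j.+2; a j.+3; a j.+4] by [].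
have loop j i : i < n -> foldl (push n) i [:: a j; a j.+1; a j.+2; a j.+3; a j.+4] = i.
  by rewrite -hds; apply: period_foldl.
have cut j : [\/ a j + a j.+1 = n, a j + a j.+1 + a j.+2 = n,
    n < a j + a j.+1 /\ a j = a j.+2 + a j.+3
    | [/\ a j + a j.+1 < n, n < a j + a j.+1 + a j.+2 & a j.+3 = a j + a j.+1]].
  apply: (cut5 (bounds j) (bounds j.+1) (bounds j.+2) (bounds j.+3) (bounds j.+4)).
  + by have := neq1 j.+4; rewrite -[(j.+4).+1]/(5 + j) a5.
  + by apply: (period_last (per_j j)); apply: (leq_trans (small j.+3)); lia.
  + by apply: loop; lia.
  by apply: loop; have := bounds j; lia.
have final j : a j.+1 + a j.+2 = n -> a j.+3 = a j + a j.+1 -> a j.+3 + a j.+4 = n ->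
    exists j, iter j (@topdrop n) p \in [set p : 'S_n | heads 5 p \in itineraries5 n].
  move=> e1 e2 e3; have a1 : a j = 1.
    by apply: (final5 (bounds j) (bounds j.+1) e1 e2 e3 (loop _ _ _)); have := bounds j; lia.
  (* The fifth head is the parameter b. Its excluded values are ruled out because heads one or two
     apart, cyclically, differ. *)
  exists j; rewrite inE hds; apply/mapP; exists (a j.+4).
    have n4 := neq1 j.+4; have n5 := neq2 j.+4.
    rewrite -[(j.+4).+1]/(5 + j) a5 in n4; rewrite -[(j.+4).+2]/(5 + j.+1) a5 in n5.
    have := bounds j.+4; have := bounds j.+1; have := neq1 j; have := neq1 j.+1.
    by have := neq1 j.+3; rewrite mem_filter mem_iota; lia.
  by congr [:: _; _; _; _; _]; lia.
have E0 : a 5 = a 0 := a5 0; have E1 : a 6 = a 1 := a5 1.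
have E2 : a 7 = a 2 := a5 2; have E3 : a 8 = a 3 := a5 3.
have := cut 4; have := cut 3; have := cut 2; have := cut 1; rewrite E0 E1 E2 => c1 c2 c3 c4.
case: (cyclic_cuts5 (bounds 0) (bounds 1) (bounds 2) (bounds 3) (bounds 4) _
  (cut 0) c1 c2 c3 c4) => [|[e1 e2 e3]|[e1 e2 e3]|[e1 e2 e3]|[[e1 e2 e3]|[e1 e2 e3]]].
- by move/esym; exact: neq1.
- exact: (final 0).
- by apply: (final 1); rewrite ?E0.
- by apply: (final 2); rewrite ?E0 ?E1.
- by apply: (final 3); rewrite ?E0 ?E1 ?E2.
by apply: (final 4); rewrite ?E0 ?E1 ?E2 ?E3.
Qed.

(** * Palindromic families of even size *)

(** In the period 2k + 2 the times k + 2, ..., 2k + 1 mirror the times k, ..., 1. *)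
Lemma heads_palindrome n k (p : 'S_n) : 1 < n -> n.-1 <= letter p 0 ->
  iter k.+1.*2 (@topdrop n) p = p ->
  heads k (iter k.+2 (@topdrop n) p) = rev (heads k (topdrop p)).
Proof.
move=> n_gt1 big per; apply: (@eq_from_nth _ 0) => [|i]; rewrite ?size_rev !size_heads // => i_k.
rewrite nth_rev size_heads // !nth_heads; [|lia..].
rewrite -iterSr -iterD (_ : (k - i.+1).+1 = k - i); last by lia.
rewrite -(palindrome_head n_gt1 big per); last by lia.
by congr (letter (iter _ _ _) _); lia.
Qed.

Lemma heads_rcons n s (p : 'S_n) :
  heads s.+1 p = rcons (heads s p) (letter (iter s (@topdrop n) p) 0).
Proof. by elim: s p => //= s IH p; rewrite IH -iterS iterSr. Qed.

(* The heads are n, w, n-1, rev w for w in L1, and A, w, A, rev w for w in L2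
   with A in {n-1, n}. An orbit of the second kind contains both w and rev w, so
   L2 may list only one of them. *)
Lemma palindromic_orbits n k (L1 L2 : seq (seq nat)) : 1 < n ->
  uniq L1 -> uniq L2 ->
  {in L1 ++ L2, forall w, all (fun a => a < n.-1) w} ->
  {in L1, forall w, good_itinerary n k.+2 (n :: rcons w n.-1)} ->
  {in L2, forall w A, n.-1 <= A <= n -> good_itinerary n k.+1 (A :: w)} ->
  {in L2, forall w A, n.-1 <= A <= n -> pull n (foldr (fun a j => pull n j a) 0 w) A = 0} ->
  {in L1 ++ L2, forall w, rev w \notin L2} ->
  size L1 * (n - k.+2)`! + (size L2).*2 * (n - k.+1)`! <= num_orbits n k.+1.*2.
Proof.
move=> n_gt1 u1 u2 small good1 good2 loop2 rev2; have n_gt0 := ltnW n_gt1.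
pose M1 := [seq n :: rcons w n.-1 | w <- L1].
pose M2 := [seq A :: w | A <- [:: n; n.-1], w <- L2].
pose F1 := [set p : 'S_n | heads k.+2 p \in M1].
pose F2 := [set p : 'S_n | heads k.+1 p \in M2].
have F1P p : p \in F1 -> [/\ letter p 0 = n, heads k (topdrop p) \in L1
    & letter (iter k.+1 (@topdrop n) p) 0 = n.-1].
  rewrite inE => /mapP[w Lw]; rewrite heads_rcons => -[-> /rcons_inj[Dw ->]].
  by rewrite Dw.
have F2P p : p \in F2 -> n.-1 <= letter p 0 <= n /\ heads k (topdrop p) \in L2.
  rewrite inE /= => /allpairsP[[A w] /= [+ Lw [-> ->]]]; rewrite !inE.
  by move=> DA; split=> //; lia.
(* By [loop2] the head after k + 1 moves comes from position 0, so it is the first head again. *)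
have F2_loop p : p \in F2 -> letter (iter k.+1 (@topdrop n) p) 0 = letter p 0.
  by move/F2P=> [A_n Lw]; rewrite letter_iter_pull //= (loop2 _ Lw).
pose F := F1 :|: F2.
have FP p : p \in F -> [/\ n.-1 <= letter p 0, heads k (topdrop p) \in L1 ++ L2
    & n.-1 <= letter (iter k.+1 (@topdrop n) p) 0].
  rewrite inE => /orP[/F1P[-> Lw ->] | F2p].
    by rewrite leq_pred leqnn mem_cat Lw.
  by rewrite (F2_loop p F2p) mem_cat; case/F2P: F2p => [/andP[-> _] ->]; rewrite orbT.
have F_per p : p \in F -> iter k.+1.*2 (@topdrop n) p = p.
  by case/FP => big _ big'; apply: iter_topdrop_palindrome.
have F_small p j : p \in F -> 0 < j < k.+1.*2 -> j != k.+1 ->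
    letter (iter j (@topdrop n) p) 0 < n.-1.
  move=> Fp; have [big Lw _] := FP p Fp.
  wlog le_jk : j / j <= k => [hw j_s j_k | j_s _].
    have [/hw-> //|gt_jk] := leqP j k.
    rewrite -(palindrome_head n_gt1 big (F_per p Fp)); last by lia.
    by apply: hw; lia.
  case: j le_jk j_s => // j j_k _; rewrite iterSr -(nth_heads _ j_k).
  by have /allP := small _ Lw; apply; rewrite mem_nth ?size_heads.
(* Half a period later the outer heads trade places and the inner heads are reversed, which leads
   out of F. *)
have F_half p : p \in F -> iter k.+1 (@topdrop n) p \notin F.
  move=> Fp; have [big Lw _] := FP p Fp; rewrite inE negb_or.
  apply/andP; split; apply/negP => Fq.
    have [Dq _] := F1P _ Fq.
    rewrite -iterD addnn (F_per p Fp).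
    move: Fp; rewrite inE => /orP[/F1P[-> _] | F2p]; first by lia.
    by rewrite -(F2_loop p F2p); lia.
  have [_] := F2P _ Fq; rewrite -iterS heads_palindrome ?(F_per p Fp) //.
  by apply/negP/rev2.
have free : {in F, forall p j, 0 < j < k.+1.*2 -> iter j (@topdrop n) p \notin F}.
  move=> p Fp j j_s; have [-> | neq] := eqVneq j k.+1; first exact: F_half.
  by apply/negP => /FP[]; rewrite leqNgt F_small.
have <- : #|F1| = size L1 * (n - k.+2)`!.
  rewrite card_heads_in ?size_map // ?map_inj_uniq // => [w1 w2 [] /rcons_inj[] //|].
  by apply/allP => _ /mapP[w Lw ->]; apply: good1.
have <- : #|F2| = (size L2).*2 * (n - k.+1)`!.
  rewrite card_heads_in //.
  - by rewrite size_allpairs mul2n.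
  - apply: allpairs_uniq => //; first by rewrite /= inE; lia.
    by move=> [A w] [B v] _ _ /= [-> ->].
  apply/allP => _ /allpairsP[[A w] /= [DA Lw ->]]; apply: good2 => //.
  by move: DA; rewrite !inE; lia.
have dis : #|F1 :&: F2| = 0.
  apply: eq_card0 => p; rewrite inE; apply/negP => /andP[F1p F2p].
  by have [D _ D'] := F1P p F1p; have := F2_loop p F2p; lia.
by rewrite -cardsUI dis addn0; apply: num_orbits_ge.
Qed.

(** * Orbits of size six *)

Lemma count_iota_double m k : count (fun y => y.*2 < m) (iota 1 k) = minn k m.-1./2.
Proof.
elim: k => [|k IH]; first by rewrite min0n.
by rewrite -[k.+1]addn1 iotaD count_cat IH /=; lia.
Qed.

(** After the heads n, x, y the next head comes from position 0 exactly when x + y = n - 1. Such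
    pairs therefore belong to the family A, w, A, rev w, where the condition 2x < n - 1 selects one
    of w and rev w. *)
Definition inner6 n := [seq [:: x; y] | x <- iota 1 (n - 2),
  y <- [seq y <- iota 1 (n - 2) | (y != x) && (y != n.-1 - x)]].

Definition inner6_sum n := [seq [:: x; n.-1 - x] | x <- [seq x <- iota 1 (n - 2) | x.*2 < n.-1]].

(** Both excluded values lie in the range, and they coincide when 2x = n - 1. *)
Lemma size_avoid2 n x : 4 <= n -> 0 < x < n.-1 ->
  size [seq y <- iota 1 (n - 2) | (y != x) && (y != n.-1 - x)] = n - 4 + (x.*2 == n.-1).
Proof.
move=> n_ge4 x_n; have := count_predC (fun y => (y != x) && (y != n.-1 - x)) (iota 1 (n - 2)).
rewrite size_iota -!size_filter.
set s := [seq _ <- _ | predC _ _]; have us : uniq s by rewrite filter_uniq ?iota_uniq.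
have Ds y : y \in s = (y == x) || (y == n.-1 - x).
  by rewrite mem_filter mem_iota /=; lia.
have [e|ne] := eqVneq x.*2 n.-1.
  rewrite (perm_size (uniq_perm us (_ : uniq [:: x]) _)) //= => [|y]; first by lia.
  by rewrite Ds !inE; lia.
have u2 : uniq [:: x; n.-1 - x] by rewrite /= inE; lia.
rewrite (perm_size (uniq_perm us u2 _)) /= => [|y]; first by lia.
by rewrite Ds !inE.
Qed.

Lemma sumn_const_count (T : Type) (c d : nat) (P : pred T) s :
  sumn [seq c + d * P x | x <- s] = size s * c + d * count P s.
Proof. by elim: s => [|x s IH] /=; rewrite ?muln0 // IH mulSn mulnDr; lia. Qed.

Lemma count_iota_eq_double m k :
  count (fun y => y.*2 == m) (iota 1 k) = (~~ odd m && (0 < m <= k.*2)).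
Proof.
elim: k => [|k IH]; first by rewrite /=; lia.
by rewrite -[k.+1]addn1 iotaD count_cat IH /=; lia.
Qed.

Lemma size_inner6 n : 4 <= n -> size (inner6 n) = (n - 2) * (n - 4) + odd n.
Proof.
move=> n_ge4; rewrite size_allpairs_dep.
rewrite (_ : [seq _ | x <- _] = [seq n - 4 + 1 * (x.*2 == n.-1) | x <- iota 1 (n - 2)]).
  by rewrite sumn_const_count size_iota count_iota_eq_double; lia.
by apply/eq_in_map => x; rewrite mem_iota => x_n; rewrite size_avoid2 //; lia.
Qed.

Lemma num_orbits6_ge n : 4 <= n ->
  ((n - 2) * (n - 4) + odd n) * (n - 4)`! + (n.-2)./2.*2 * (n - 3)`! <= num_orbits n 6.
Proof.
move=> n_ge4; have n_gt1 : 1 < n by lia.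
have /= := @palindromic_orbits n 2 (inner6 n) (inner6_sum n) n_gt1.
rewrite size_inner6 // size_map size_filter count_iota_double.
rewrite (_ : minn (n - 2) n.-2./2 = n.-2./2); last by lia.
apply.
- apply: allpairs_uniq_dep => [|x _|[x y] [x' y'] _ _ /= [-> ->]] //;
  by rewrite ?filter_uniq ?iota_uniq.
- by rewrite map_inj_uniq ?filter_uniq ?iota_uniq // => x y [].
- move=> w; rewrite mem_cat => /orP[/allpairsPdep[x [y []]] | /mapP[x]];
  by rewrite !mem_filter !mem_iota => *; subst w; rewrite /=; lia.
- move=> w /allpairsPdep[x [y []]]; rewrite !mem_filter !mem_iota => x_n y_n ->.
  by rewrite /good_itinerary /= !inE; eval_pull; lia.
- move=> w /mapP[x]; rewrite !mem_filter !mem_iota => x_n -> A A_n.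
  by rewrite /good_itinerary /= !inE; eval_pull; lia.
- move=> w /mapP[x]; rewrite !mem_filter !mem_iota => x_n -> A A_n.
  by rewrite /=; eval_pull; lia.
move=> w; rewrite mem_cat => /orP[/allpairsPdep[x [y []]] | /mapP[x]];
  rewrite !mem_filter !mem_iota => *; subst w;
  by apply/mapP => -[z]; rewrite mem_filter mem_iota => ? [] *; lia.
Qed.

(** * Orbits of size eight *)

Definition avoid2 n y := [seq x <- iota 1 (n - 2) | (x != y) && (x != n.-1 - y)].

Definition outer8 n y := [seq (x, z) | x <- avoid2 n y, z <- [seq z <- avoid2 n y | z != x]].

(** The middle letter y is chosen first because x and z have to avoid y, n - 1 - y and each
    other. *)
Definition inner8 n := [seq [:: u.1; y; u.2] | y <- iota 1 (n - 2), u <- outer8 n y].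

Lemma uniq_inner8 n : uniq (inner8 n).
Proof.
apply: allpairs_uniq_dep => [|y _|[y [x z]] [y' [x' z']] _ _ /= [-> -> ->]] //.
  exact: iota_uniq.
by apply: allpairs_uniq_dep => [|x _|[x z] [x' z'] _ _ /= [-> ->]] //;
  rewrite ?filter_uniq ?iota_uniq.
Qed.

Lemma inner8P n w : reflect (exists x y z, [/\ w = [:: x; y; z],
    0 < x < n.-1 /\ 0 < y < n.-1, 0 < z < n.-1 &
    [&& x != y, x != n.-1 - y, z != y, z != n.-1 - y & z != x]]) (w \in inner8 n).
Proof.
apply: (iffP allpairsPdep) => [[y [u [y_n /allpairsPdep[x [z [x_n z_n ->]]] ->]]] | ].
  rewrite /avoid2 !mem_filter !mem_iota in y_n x_n z_n.
  by exists x, y, z; split=> //; lia.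
move=> [x [y [z [-> [x_n y_n] z_n cond]]]]; exists y, (x, z); split=> //.
  by rewrite mem_iota; lia.
apply/allpairsPdep; exists x, z.
by rewrite /avoid2 !mem_filter !mem_iota; split=> //; lia.
Qed.

(** For fixed y there are N (N - 1) pairs of x and z, with N = n - 4 in general and N = n - 3 when
    2y = n - 1; the excess in the latter case is 2 (n - 4). *)
Lemma size_inner8 n : 4 <= n ->
  size (inner8 n) = (n - 2) * ((n - 4) * (n - 5)) + odd n * (2 * (n - 4)).
Proof.
move=> n_ge4; have -> : size (inner8 n) =
    sumn [seq (n - 4) * (n - 5) + 2 * (n - 4) * (y.*2 == n.-1) | y <- iota 1 (n - 2)].
  rewrite size_allpairs_dep; congr sumn; apply/eq_in_map => y; rewrite mem_iota => y_n.
  have u : uniq (avoid2 n y) by rewrite filter_uniq ?iota_uniq.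
  rewrite size_allpairs_dep.
  rewrite (_ : [seq _ | x <- _] = [seq (size (avoid2 n y)).-1 + 0 * true | x <- avoid2 n y]).
    rewrite sumn_const_count size_avoid2 //; last by lia.
    by case: (y.*2 == n.-1) => /=; nia.
  by apply/eq_in_map => x x_s; rewrite -(rem_filter _ u) size_rem // mul0n addn0.
rewrite sumn_const_count size_iota count_iota_eq_double; congr (_ + _).
by rewrite mulnC; congr (_ * _); lia.
Qed.

Lemma sumn_subn_iota k : (sumn [seq k - y | y <- iota 1 k]).*2 = k * k.-1.
Proof.
elim: k => // k IH; rewrite /= subSS subn0 -[2]addn1 addnC iotaDl -map_comp.
rewrite (_ : [seq _ | y <- _] = [seq k - y | y <- iota 1 k]).
  by rewrite doubleD IH; case: k {IH} => //= k; nia.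
by apply: eq_map => y /=; rewrite add1n subSS.
Qed.

Lemma count_even_diff k : count (fun y => ~~ odd (k.+1 - y)) (iota 1 k) = k./2.
Proof.
elim: k => // k IH; rewrite /= -[2]addn1 addnC iotaDl count_map.
rewrite (eq_count (a2 := fun y => ~~ odd (k.+1 - y))) ?IH; first by lia.
by move=> y /=; rewrite add1n subSS.
Qed.

Lemma count_iota_eq_triple m k :
  count (fun y => 3 * y == m) (iota 1 k) = (3 %| m) && (0 < m <= 3 * k).
Proof.
elim: k => [|k IH]; first by rewrite /=; lia.
by rewrite -[k.+1]addn1 iotaD count_cat IH /=; lia.
Qed.

Lemma leq_sumn_count (f g : nat -> nat) (P Q R : pred nat) s :
  {in s, forall y, f y + 2 * P y <= g y + (2 * Q y + R y)} ->
  sumn (map f s) + 2 * count P s <= sumn (map g s) + (2 * count Q s + count R s).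
Proof.
elim: s => //= y s IH H; have := H y (mem_head _ _).
by have /IH : {in s, forall y, f y + 2 * P y <= g y + (2 * Q y + R y)};
  [move=> z zs; apply: H; rewrite inE zs orbT | lia].
Qed.

(** With z = m - x - y the three conditions read x <> y, z <> y and x <> z. For 2y >= m the
    truncated difference is 0 and excludes no x. *)
Definition sum_outer m y :=
  [seq x <- iota 1 (m.-1 - y) | [&& x != y, x != m - y.*2 & x.*2 != m - y]].

(* The three coincidences x = y, z = y and x = z of a triple x + y + z = m are
   simultaneous as soon as two of them hold. *)
Lemma size_sum_outer m y : 0 < y < m ->
  m.-1 - y + 2 * (3 * y == m) <=
  size (sum_outer m y) + (2 * (y.*2 < m) + ~~ odd (m - y)).
Proof.
move=> y_m; set P := fun x => [&& x != y, x != m - y.*2 & x.*2 != m - y].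
have := count_predC P (iota 1 (m.-1 - y)); rewrite size_iota -!size_filter -/(sum_outer m y).
set s := filter (predC P) _; have us : uniq s by rewrite filter_uniq ?iota_uniq.
have s_sub t : (forall x, 0 < x < m - y -> ~~ P x -> x \in t) -> size s <= size t.
  move=> sub; apply: uniq_leq_size => // x; rewrite mem_filter mem_iota => /andP[Px x_m].
  by apply: sub => //; lia.
have [e|ne] := eqVneq (3 * y) m.
  have := s_sub [:: y]; rewrite /P /= => /(_ _)/wrap[x x_m|]; last by lia.
  by rewrite inE; lia.
have [lt|ge] := ltnP y.*2 m; have [o|ev] := boolP (odd (m - y)).
- have := s_sub [:: y; m - y.*2]; rewrite /P /= => /(_ _)/wrap[x x_m|]; last by lia.
  by rewrite !inE; lia.
- have := s_sub [:: y; m - y.*2; (m - y)./2]; rewrite /P /= => /(_ _)/wrap[x x_m|]; last by lia.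
  by rewrite !inE; lia.
- have := s_sub [::]; rewrite /P /= => /(_ _)/wrap[x x_m|]; last by lia.
  by rewrite ?inE; lia.
- have := s_sub [:: (m - y)./2]; rewrite /P /= => /(_ _)/wrap[x x_m|]; last by lia.
  by rewrite !inE; lia.
Qed.

(** For x + y + z = n - 1 the head after A, x, y, z comes from position 0, so these w belong to the
    family A, w, A, rev w. *)
Definition inner8_sum n := [seq w <- inner8 n | sumn w == n.-1].

(** Among the positive triples with sum m = n - 1, each coincidence of two entries occurs (m - 1)/2
    times, rounded down. If 3 divides m, the triple with equal entries is removed three times and
    must be counted back twice. Doubling clears the denominator of the triangular number. *)
Lemma size_inner8_sum n : 5 <= n ->
  (n - 2) * (n - 3) + 4 * (3 %| n.-1) <= (size (inner8_sum n)).*2 + 6 * ((n - 2)./2).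
Proof.
move=> n_ge5; set m := n.-1.
have Dm : n - 2 = m.-1 by lia.
pose E := [seq [:: x; y; m - x - y] | y <- iota 1 m.-1, x <- sum_outer m y].
have leE : size E <= size (inner8_sum n).
  apply: uniq_leq_size => [|w].
    apply: allpairs_uniq_dep => [|y _|[y x] [y' x'] _ _ /= [-> ->]] //;
    by rewrite ?filter_uniq ?iota_uniq.
  case/allpairsPdep=> y [x []]; rewrite mem_filter !mem_iota => y_m x_m ->.
  rewrite mem_filter; apply/andP; split; first by rewrite /= -/m; lia.
  by apply/inner8P; exists x, y, (m - x - y); rewrite -/m; split=> //; lia.
have sE : size E = sumn [seq size (sum_outer m y) | y <- iota 1 m.-1] by rewrite size_allpairs_dep.
have := @leq_sumn_count (fun y => m.-1 - y) (fun y => size (sum_outer m y))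
  (fun y => 3 * y == m) (fun y => y.*2 < m) (fun y => ~~ odd (m - y)) (iota 1 m.-1).
rewrite -sE count_iota_eq_triple count_iota_double.
have -> : count (fun y => ~~ odd (m - y)) (iota 1 m.-1) = m.-1./2.
  by rewrite -[in RHS](count_even_diff m.-1) prednK //; lia.
move=> H; have {H} := H _; rewrite -Dm.
have := sumn_subn_iota m.-1; rewrite Dm.
set S := sumn _ => DS H.
have {H} : S + 2 * ((3 %| m) && (0 < m <= 3 * m.-1)) <=
    size E + (2 * minn m.-1 m.-1./2 + m.-1./2).
  by apply: H => y; rewrite mem_iota => y_m; apply: size_sum_outer; lia.
by rewrite (_ : n - 3 = m.-1.-1); lia.
Qed.

(** Each w contributes (n - 5)!, except that those with sum n - 1 contribute (n - 4)! = (n - 5)! +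
    (n - 5) (n - 5)!. *)
Lemma num_orbits8_ge n : 5 <= n ->
  (size (inner8 n) + size (inner8_sum n) * (n - 5)) * (n - 5)`! <= num_orbits n 8.
Proof.
move=> n_ge5; have n_gt1 : 1 < n by lia.
pose L1 := [seq w <- inner8 n | sumn w != n.-1].
pose L2 := [seq w <- inner8_sum n | head 0 w < last 0 w].
have uS : uniq (inner8_sum n) by rewrite filter_uniq ?uniq_inner8.
have s1 : size (inner8 n) = size L1 + size (inner8_sum n).
  by rewrite -(count_predC (fun w => sumn w == n.-1) (inner8 n)) addnC -!size_filter.
(* Reversal exchanges the triples with x < z and those with x > z, and x = z does not occur. *)
have s2 : size (inner8_sum n) = (size L2).*2.
  rewrite -(count_predC (fun w => head 0 w < last 0 w) (inner8_sum n)) -!size_filter -/L2 -addnn.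
  congr (_ + _); rewrite -(size_map rev L2); apply/perm_size/uniq_perm.
  - by rewrite filter_uniq.
  - by rewrite (map_inj_uniq (inv_inj (@revK nat))) filter_uniq.
  move=> w; rewrite -[w in RHS]revK (mem_map (inv_inj (@revK nat))) !mem_filter.
  apply/and3P/and3P => -[lt sm /inner8P[x [y [z [Dw xy_n z_n cond]]]]].
    subst w; move: lt sm; rewrite /rev /= => lt sm; split; try lia.
    by apply/inner8P; exists z, y, x; split=> //; lia.
  have {}Dw : w = [:: z; y; x] by rewrite -[w]revK Dw.
  subst w; move: lt sm; rewrite /rev /= => lt sm; split; try lia.
  by apply/inner8P; exists z, y, x; split=> //; lia.
have -> : (size (inner8 n) + size (inner8_sum n) * (n - 5)) * (n - 5)`! =
    size L1 * (n - 5)`! + (size L2).*2 * (n - 4)`!.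
  rewrite s1 -s2 (_ : n - 4 = (n - 5).+1) ?factS; last by lia.
  by rewrite !mulnDl -addnA mulnA mulnS mulnDl.
have L1P w : w \in L1 -> exists x y z, [/\ w = [:: x; y; z],
    0 < x < n.-1 /\ 0 < y < n.-1, 0 < z < n.-1,
    [&& x != y, x != n.-1 - y, z != y, z != n.-1 - y & z != x] & x + y + z != n.-1].
  rewrite mem_filter => /andP[sm /inner8P[x [y [z [Dw xy_n z_n cond]]]]].
  by exists x, y, z; split=> //; move: sm; rewrite Dw /=; lia.
have L2P w : w \in L2 -> exists x y z, [/\ w = [:: x; y; z],
    0 < x < n.-1 /\ 0 < y < n.-1, 0 < z < n.-1,
    [&& x != y, x != n.-1 - y, z != y, z != n.-1 - y & z != x] & x < z /\ x + y + z = n.-1].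
  rewrite !mem_filter => /and3P[lt sm /inner8P[x [y [z [Dw xy_n z_n cond]]]]].
  by exists x, y, z; split=> //; move: sm lt; rewrite Dw /=; lia.
apply: (@palindromic_orbits n 3 L1 L2) => //.
- by rewrite filter_uniq ?uniq_inner8.
- by rewrite filter_uniq.
- by move=> w; rewrite mem_cat => /orP[/L1P | /L2P] [x [y [z [-> xy_n z_n _ _]]]] /=; lia.
- move=> w /L1P[x [y [z [-> [x_n y_n] z_n cond sm]]]].
  rewrite /good_itinerary /= !inE !negb_or; move: cond sm; eval_pull => /and5P[c1 c2 c3 c4 c5] sm;
  by do !(apply/andP; split); first [clear c1 c2 c3 c4 c5 sm; lia | lia].
- move=> w /L2P[x [y [z [-> [x_n y_n] z_n cond sm]]]] A A_n.
  rewrite /good_itinerary /= !inE !negb_or; move: cond sm; eval_pull => /and5P[c1 c2 c3 c4 c5] sm;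
  by do !(apply/andP; split); first [clear c1 c2 c3 c4 c5 sm; lia | lia].
- move=> w /L2P[x [y [z [-> [x_n y_n] z_n cond sm]]]] A A_n.
  by rewrite /=; move: cond sm; eval_pull => _ sm; lia.
move=> w; rewrite mem_cat => /orP[/L1P | /L2P] [x [y [z [-> [x_n y_n] z_n cond sm]]]];
  by apply/negP => /L2P[x' [y' [z' [[*]]]]]; lia.
Qed.

(** * Rational form of the lower bounds *)

Lemma mul_le_natQ (K f N : nat) (c : rat) :
  (c <= K%:R)%R -> K * f <= N -> (c * f%:Q <= N%:Q)%R.
Proof.
move=> cK KfN; rewrite -!pmulrn; apply: (le_trans (y := (K%:R * f%:R)%R)).
  by apply: ler_wpM2r.
by rewrite -natrM ler_nat.
Qed.

Lemma num_orbits6_geQ n : 4 <= n -> exists2 K : nat,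
  (K%:R = (n%:R - 2) * (n%:R - 4) + (odd n)%:R + (n%:R - 2 - (odd n)%:R) * (n%:R - 3) :> rat)%R
  & K * (n - 4)`! <= num_orbits n 6.
Proof.
move=> n_ge4; have := num_orbits6_ge n_ge4.
have [m Dn] : exists m, n = m + 4 by exists (n - 4); lia.
rewrite Dn !addnK (_ : m + 4 - 3 = m.+1) ?factS; last by lia.
rewrite mulnA -mulnDl; set h := _.*2; set K := _ + h * _ => le_K.
exists K => //.
have -> : K = ((m + 2) * m + odd (m + 4) + h * (m + 1))%N by rewrite /K; lia.
(* Twice the rounded-down half of n - 2 is n - 2 minus the parity of n, here with n = m + 4. *)
have Eh : (h%:R + (odd (m + 4))%:R = m%:R + 2%:R :> rat)%R.
  by rewrite -!natrD; congr (_%:R)%R; rewrite /h; lia.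
rewrite !(natrD, natrM).
have -> : (h%:R = m%:R + 2%:R - (odd (m + 4))%:R :> rat)%R by rewrite -Eh addrK.
by ring.
Qed.

Lemma num_orbits8_geQ n : 5 <= n -> exists2 K : nat,
  ((n%:R - 2) * ((n%:R - 4) * (n%:R - 5)) + (odd n)%:R * (2 * (n%:R - 4))
   + ((n%:R - 2) * (n%:R - 3) + 4 * (3 %| n.-1)%:R - 3 * (n%:R - 2 - (odd n)%:R)) / 2
     * (n%:R - 5) <= K%:R :> rat)%R
  & K * (n - 5)`! <= num_orbits n 8.
Proof.
move=> n_ge5; have le_K := num_orbits8_ge n_ge5; eexists; last exact: le_K.
have {le_K} := size_inner8_sum n_ge5; rewrite size_inner8; last by lia.
move: (size _) => D leD.
have [m Dn] : exists m, n = m + 5 by exists (n - 5); lia.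
rewrite (_ : n - 2 = m + 3)%N in leD *; last by lia.
rewrite (_ : n - 3 = m + 2)%N in leD; last by lia.
rewrite (_ : n - 4 = m + 1)%N; last by lia.
rewrite (_ : n - 5 = m)%N; last by lia.
have {}leD : (m + 3) * (m + 2) + 4 * (3 %| n.-1) + 3 * odd n <= 2 * D + 3 * (m + 3) by lia.
have -> : (n%:R = m%:R + 5 :> rat)%R by rewrite Dn natrD.
move: leD; rewrite -(ler_nat rat) !(natrD, natrM).
move: (odd n : nat) (3 %| _ : nat) => o e.
(* The lower bound on D has to be multiplied by m = n - 5, which is nonnegative. *)
have m_ge0 := ler0n rat m; move=> leD_Q; have := ler_wpM2r m_ge0 leD_Q; nra.
Qed.

Theorem theorem4p3 (n : nat) :
  (2 <= n -> num_orbits n 2 = (n - 2)`!) /\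
  (num_orbits n 3 = 0) /\
  (3 <= n -> num_orbits n 4 = (n - 2)`!) /\
  (7 <= n ->
     (~~ odd n -> num_orbits n 5 = (n - 6) * (n - 5)`!) /\
     (odd n -> num_orbits n 5 = (n - 5) * (n - 5)`!)) /\
  (4 <= n ->
     (~~ odd n ->
        ((2 * n%:Q ^+ 2 - 11 * n%:Q + 14) * ((n - 4)`!)%:Q
           <= (num_orbits n 6)%:Q)%R) /\
     (odd n ->
        ((2 * n%:Q ^+ 2 - 12 * n%:Q + 18) * ((n - 4)`!)%:Q
           <= (num_orbits n 6)%:Q)%R)) /\
  (5 <= n ->
     (n %% 6 = 0 \/ n %% 6 = 2 ->
        ((3 / 2 * n%:Q ^+ 3 - 35 / 2 * n%:Q ^+ 2 + 64 * n%:Q - 70)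
           * ((n - 5)`!)%:Q <= (num_orbits n 8)%:Q)%R) /\
     (n %% 6 = 1 ->
        ((3 / 2 * n%:Q ^+ 3 - 35 / 2 * n%:Q ^+ 2 + 137 / 2 * n%:Q - 181 / 2)
           * ((n - 5)`!)%:Q <= (num_orbits n 8)%:Q)%R) /\
     (n %% 6 = 3 \/ n %% 6 = 5 ->
        ((3 / 2 * n%:Q ^+ 3 - 35 / 2 * n%:Q ^+ 2 + 135 / 2 * n%:Q - 171 / 2)
           * ((n - 5)`!)%:Q <= (num_orbits n 8)%:Q)%R) /\
     (n %% 6 = 4 ->
        ((3 / 2 * n%:Q ^+ 3 - 35 / 2 * n%:Q ^+ 2 + 66 * n%:Q - 80)
           * ((n - 5)`!)%:Q <= (num_orbits n 8)%:Q)%R)).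

Proof.
split; first exact: num_orbits2.
split; first exact: num_orbits3.
split; first exact: num_orbits4.
split=> [n_ge7|].
  by split=> odd_n; rewrite num_orbits5 //; [rewrite (negPf odd_n) | rewrite odd_n].
split=> [n_ge4 | n_ge5].
  have [K DK leK] := num_orbits6_geQ n_ge4.
  have n_ge : (4%:R <= n%:R :> rat)%R by rewrite ler_nat.
  by split=> odd_n; apply: mul_le_natQ leK; rewrite DK ?odd_n ?(negPf odd_n) -!pmulrn /=; nra.
have [K leK le_orb] := num_orbits8_geQ n_ge5.
have n_ge : (5%:R <= n%:R :> rat)%R by rewrite ler_nat.
have sq_ge0 : (0 <= (n%:R - 5) * (n%:R - 5) :> rat)%R by rewrite mulr_ge0 // subr_ge0.
(* The bound depends on n only through its value, its parity and the divisibility of n - 1 by 3; the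
   last two are read off n modulo 6. *)
have step r : n %% 6 = r -> odd n = odd r /\ (3 %| n.-1) = ((r == 1) || (r == 4)) by lia.
split=> [|]; last split=> [|]; last split=> [|]; last by move/step=> [Do De];
  apply: mul_le_natQ le_orb;
  apply: le_trans leK; rewrite Do De -!pmulrn /=; nra.
by case=> /step[Do De]; apply: mul_le_natQ le_orb;
  apply: le_trans leK; rewrite Do De -!pmulrn /=; nra.
by move/step=> [Do De]; apply: mul_le_natQ le_orb;
  apply: le_trans leK; rewrite Do De -!pmulrn /=; nra.
by case=> /step[Do De]; apply: mul_le_natQ le_orb;
  apply: le_trans leK; rewrite Do De -!pmulrn /=; nra.
Qed.
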